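(* Let $(X,\mathcal{A},\mu)$ be a measure space, where $\mu$ is an arbitrary positive measure on the $\sigma$-algebra $\mathcal{A}$. Let $(u_n)_n\subset L^1(X)$ and $u\in L^1(X)$ be such that $u_n\rightharpoonup u$ weakly in $L^1(X)$. Then there is a subsequence $(u_{n_j})_j$ such that $$\sup_{\theta}\Big\|\frac{1}{j}\sum_{k=1}^{j}u_{n_{\theta(k)}}-u\Big\|_{L^1(X)}\xrightarrow{j\to\infty}0,$$ where, for each $j$, the supremum is taken over all strictly increasing maps $\theta:\mathbb{N}\to\mathbb{N}$.
   Context: $L^1(X)$ denotes the usual Lebesgue space associated with the measure space $(X,\mathcal{A},\mu)$; no restriction (such as finiteness or $\sigma$-finiteness) is imposed on $\mu$. A sequence $(u_n)_n\subset L^1(X)$ converges weakly to $u$ in $L^1(X)$, written $u_n\rightharpoonup u$, if $(v,u_n-u)_{(L^1(X))',L^1(X)}\to 0$ as $n\to\infty$ for all $v\in (L^1(X))'$, where $(L^1(X))'$ is the (continuous) dual space of $L^1(X)$ and $(\cdot,\cdot)_{(L^1(X))',L^1(X)}$ is the dual pairing. A subsequence $(u_{n_j})_j$ is given by a strictly increasing sequence of indices $n_1<n_2<\cdots$. Here $\mathbb{N}=\{1,2,3,\dots\}$. *)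

(* Defs.v *)
From mathcomp Require Export all_boot all_order all_algebra.
From mathcomp Require Export all_classical all_reals all_analysis.

Set Implicit Arguments.
Unset Strict Implicit.
Unset Printing Implicit Defensive.

Export Order.TTheory GRing.Theory Num.Theory.
Export numFieldNormedType.Exports.

Open Scope classical_set_scope.
Open Scope ring_scope.

(* Real-valued integrable functions. Elements are functions, not classes modulo
   almost-everywhere equality: the library's quotient [LspaceType] carries no
   linear structure. Everything below depends on functions only through the
   L1 seminorm, hence only on their classes. *)
Notation L1fun mu := (LfunType mu (@lexx _ _ 1%E)).

Definition L1norm (d : measure_display) (T : measurableType d) (R : realType)
    (mu : {measure set T -> \bar R}) (f : L1fun mu) : R :=
  fine ('N[mu]_1[EFin \o f])%E.

(* A functional continuous for the seminorm is constant on classes modulo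
   almost-everywhere equality, so the linear functionals satisfying this are
   exactly the elements of the continuous dual of the normed quotient. *)
Definition L1_continuous (d : measure_display) (T : measurableType d)
    (R : realType) (mu : {measure set T -> \bar R}) (v : L1fun mu -> R) : Prop :=
  forall (f : L1fun mu) (e : R), 0 < e ->
    exists2 r : R, 0 < r &
      forall g : L1fun mu, L1norm (g - f) < r -> `|v g - v f| < e.

Definition L1_weak_cvg (d : measure_display) (T : measurableType d)
    (R : realType) (mu : {measure set T -> \bar R})
    (u_ : nat -> L1fun mu) (u : L1fun mu) : Prop :=
  forall v : {scalar L1fun mu}, L1_continuous v ->
    v (u_ n - u) @[n --> \oo] --> 0.

(* Main.v *)
From HB Require Import structures.
Require Import Defs.
From mathcomp Require Import measurable_realfun ring lra zify.

(** Put f_n = u_n - u. Integration against a measurable h with |h| <= 1 is a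
continuous functional for every measure, so the integral of f_n h tends to 0
([weakly_null]); the proof works with these functionals only.

Uniform integrability is put in a form that makes sense for a measure that is
not sigma-finite: for every e there is an integrable b >= 0 such that truncating
each f_n to the band [-b, b] costs at most e in L1 norm
([weakly_null_almost_order_bounded]). It rests on
[equi_absolutely_continuous], a Baire category argument made explicit: if the
integrals of the f_n were not equi-absolutely continuous with respect to the
envelopes |f_0| + ... + |f_(N-1)|, one could perturb a test function again and
again, each time by less than what the f_n already treated can detect, and the
limit would be a test function against which f_n does not tend to 0. Applied to
small multiples of sgn f_n, equi-absolute continuity also gives boundedness in
L1.

The truncations t_n of the f_n are bounded in the Hilbert space with inner
product <s, t> = integral of s t / b. Limits along an ultrafilter yield a
single subsequence along which, for all the accuracies e = 1/(i+1) at once (each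
with its own b), <t_j, t_k> is close to a number l as soon as j < k and j is
large ([extract_double_limit]). Let x and y be increasing index maps such that
the values of y exceed those x_p that occur. Then the vectors
t_(x_p) - t_(y_p) are almost orthogonal to each other, because the four inner
products that make up <t_(x_p) - t_(y_p), t_(x_q) - t_(y_q)> are all close to l
and cancel. So the mean of these vectors over p < j is small in the Hilbert
norm, hence in L1 as b is integrable, with a bound that does not depend on x
and y ([intg_sum_differences_le]): this is where the uniformity in theta comes
from.

Consequently two means of the f_n, one along theta and one along indices far
beyond those of the first, are close to each other in L1. When the second block
of indices is pushed to infinity its means tend weakly to 0, and by weak lower
semicontinuity of the norm ([weak_limit_norm_le]) the first mean is small. *)

Set Implicit Arguments.
Unset Strict Implicit.
Unset Printing Implicit Defensive.

(** * Integrable functions and bounded test functions *)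

Section integrable_functions.
Context (d : measure_display) (T : measurableType d) (R : realType)
  (mu : {measure set T -> \bar R}).
Implicit Types f g h : T -> R.

Definition L1 f := mu.-integrable setT (EFin \o f).
Definition intg f : R := \int[mu]_x f x.
Definition test_fun h := measurable_fun setT h /\ forall x, `|h x| <= 1.

Lemma L1_measurable f : L1 f -> measurable_fun setT f.
Proof. by move=> /integrableP[/measurable_EFinP]. Qed.

Lemma L1_le f g : measurable_fun setT f -> (forall x, `|f x| <= `|g x|) ->
  L1 g -> L1 f.
Proof.
move=> mf fg; apply: le_integrable => //; first exact/measurable_EFinP.
by move=> x _ /=; rewrite lee_fin.
Qed.

Lemma L1D f g : L1 f -> L1 g -> L1 (fun x => f x + g x).
Proof. by move=> lf lg; have := integrableD measurableT lf lg. Qed.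

Lemma L1B f g : L1 f -> L1 g -> L1 (fun x => f x - g x).
Proof. by move=> lf lg; have := integrableB measurableT lf lg. Qed.

Lemma L1Z a f : L1 f -> L1 (fun x => a * f x).
Proof. by move=> lf; have := integrableZl measurableT a lf. Qed.

Lemma L1_abs f : L1 f -> L1 (fun x => `|f x|).
Proof. exact: integrable_norm. Qed.

Lemma L1_sum J (s : seq J) (F : J -> T -> R) :
  (forall i, L1 (F i)) -> L1 (fun x => \sum_(i <- s) F i x).
Proof.
move=> lF; elim: s => [|i s ih].
  under [X in L1 X]funext do rewrite big_nil.
  exact: integrable0.
under [X in L1 X]funext do rewrite big_cons.
exact: L1D.
Qed.

Lemma L1M f h : L1 f -> test_fun h -> L1 (fun x => f x * h x).
Proof.
move=> lf [mh h1]; apply: L1_le (lf).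
  by apply: measurable_funM => //; exact: L1_measurable.
by move=> x; rewrite normrM ler_piMr.
Qed.

Lemma intgD f g : L1 f -> L1 g ->
  intg (fun x => f x + g x) = intg f + intg g.
Proof. by move=> lf lg; rewrite /intg RintegralD. Qed.

Lemma intgB f g : L1 f -> L1 g ->
  intg (fun x => f x - g x) = intg f - intg g.
Proof. by move=> lf lg; rewrite /intg RintegralB. Qed.

Lemma intgZ a f : L1 f -> intg (fun x => a * f x) = a * intg f.
Proof. by move=> lf; rewrite /intg RintegralZl. Qed.

Lemma intg_sum J (s : seq J) (F : J -> T -> R) : (forall i, L1 (F i)) ->
  intg (fun x => \sum_(i <- s) F i x) = \sum_(i <- s) intg (F i).
Proof.
move=> lF; elim: s => [|i s ih].
  under [X in intg X]funext do rewrite big_nil.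
  by rewrite big_nil /intg /Rintegral integral0.
under [X in intg X]funext do rewrite big_cons.
by rewrite intgD// ?big_cons ?ih//; exact: L1_sum.
Qed.

Lemma le_intg f g : L1 f -> L1 g -> (forall x, f x <= g x) -> intg f <= intg g.
Proof. by move=> lf lg fg; apply: le_Rintegral. Qed.

Lemma intg_ge0 f : (forall x, 0 <= f x) -> 0 <= intg f.
Proof. by move=> f0; apply: Rintegral_ge0. Qed.

Lemma intg_abs f : L1 f -> `|intg f| <= intg (fun x => `|f x|).
Proof. by move=> lf; apply: le_normr_Rintegral. Qed.

Lemma intg_abs_le f g : L1 f -> L1 g -> (forall x, `|f x| <= g x) ->
  `|intg f| <= intg g.
Proof.
move=> lf lg fg; apply: (le_trans (intg_abs lf)).
by apply: le_intg => //; exact: L1_abs.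
Qed.

Lemma EFin_intg f : L1 f -> (intg f)%:E = (\int[mu]_x (f x)%:E)%E.
Proof.
by move=> lf; rewrite /intg /Rintegral fineK//; exact: integrable_fin_num.
Qed.

Lemma L1fun_L1 (f : L1fun mu) : L1 f.
Proof. exact/Lfun1_integrable/LfunP. Qed.

Lemma L1normE (f : L1fun mu) : L1norm f = intg (fun x => `|f x|).
Proof. by rewrite /L1norm Lnorm1. Qed.

Lemma test_fun_sg f : measurable_fun setT f -> test_fun (fun x => Num.sg (f x)).
Proof.
move=> mf; split => [|x]; last by rewrite normr_sg; case: (_ != 0).
have : measurable_fun setT (Num.sg \o f); last by [].
apply: measurableT_comp mf; apply: nondecreasing_measurable => // x y xy.
case: (sgrP x) => x0; case: (sgrP y) => y0 //; lra.
Qed.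

(** A test function h induces a linear functional that is 1-Lipschitz for the L1
norm, whatever the measure. *)
Lemma weak_cvg_test (u_ : nat -> L1fun mu) (u : L1fun mu) h :
  L1_weak_cvg u_ u -> test_fun h ->
  intg (fun x => (u_ n x - u x) * h x) @[n --> \oo] --> 0.
Proof.
move=> wu th.
pose v (f : L1fun mu) := intg (fun x => f x * h x).
have vl : scalar v.
  move=> a f g; rewrite /v /=.
  have -> : (fun x => (a *: f + g) x * h x) =
            (fun x => a * (f x * h x) + g x * h x).
    by apply/funext => x /=; rewrite mulrDl mulrA.
  rewrite intgD ?intgZ//; last 2 first.
  - exact: (L1Z _ (L1M (L1fun_L1 _) th)).
  - exact: (L1M (L1fun_L1 _) th).
  - exact: (L1M (L1fun_L1 _) th).
pose vL := GRing.isLinear.Build R (L1fun mu) R^o *%R v vl.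
pose vS : {scalar L1fun mu} := HB.pack v vL.
have -> : (fun n => intg (fun x => (u_ n x - u x) * h x)) =
          (fun n => vS (u_ n - u)) by [].
apply: wu => f e e0; exists e => // g ge.
apply: (le_lt_trans _ ge).
rewrite -raddfB/= L1normE /v.
apply: intg_abs_le.
- exact: (L1M (L1fun_L1 _) th).
- exact: L1_abs (L1fun_L1 _).
- by case: th => _ h1 x; rewrite normrM ler_piMr.
Qed.

End integrable_functions.

(** * Equi-absolute continuity of weakly null sequences *)

Lemma limn_esup_between (R : realType) (w : nat -> R) (a b : R) (K : nat) :
  (forall n, (K <= n)%N -> a <= w n <= b) ->
  a <= fine (limn_esup (fun n => (w n)%:E)) <= b.
Proof.
move=> wab.
have le_b : (limn_esup (fun n => (w n)%:E) <= b%:E)%E.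
  apply: (@le_trans _ _ (ereal_sup [set (w n)%:E | n in [set n | (K <= n)%N]])).
    by apply: ereal_inf_lbound; exists [set n | (K <= n)%N] => //; exists K.
  by apply: ge_ereal_sup => _ [n /= Kn <-]; rewrite lee_fin; case/andP: (wab n Kn).
have ge_a : (a%:E <= limn_esup (fun n => (w n)%:E))%E.
  apply: le_ereal_inf_tmp => _ [A [m _ mA] <-].
  have Am : A (maxn K m) by apply: mA; rewrite /= leq_maxr.
  apply: (le_trans _ (ereal_sup_ubound (_ : _ (w (maxn K m))%:E))); last first.
    by exists (maxn K m).
  by rewrite lee_fin; case/andP: (wab _ (leq_maxl K m)).
move: le_b ge_a; case: (limn_esup _) => [r| |] //=.
by rewrite !lee_fin => -> ->.
Qed.

Section equi_absolute_continuity.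
Context (d : measure_display) (T : measurableType d) (R : realType)
  (mu : {measure set T -> \bar R}).
Implicit Types f g h : T -> R.
Local Notation L1 := (L1 mu).
Local Notation intg := (intg mu).

Definition limsup_fun (g_ : nat -> T -> R) x : R :=
  fine (limn_esup (fun n => (g_ n x)%:E)).

Lemma test_fun_limsup (g_ : nat -> T -> R) : (forall n, test_fun (g_ n)) ->
  test_fun (limsup_fun g_).
Proof.
move=> tg; split.
  apply: (@measurableT_comp _ _ _ _ _ _ (@fine R)); first exact: fine_measurable.
  by apply: measurable_fun_limn_esup => n; apply/measurable_EFinP; case: (tg n).
move=> x; rewrite ler_norml; apply: (@limn_esup_between _ _ _ _ 0%N) => n _.
by rewrite -ler_norml; case: (tg n).
Qed.

(** The increments dominate |g_n - g_K| pointwise, also at the points where the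
sequence diverges: there the series of the increments weighted by w is infinite,
unless w vanishes. So integrating the series term by term suffices. *)
Lemma intg_limsup_le (g_ : nat -> T -> R) w K (e : R) :
    (forall n, test_fun (g_ n)) -> L1 w -> (forall x, 0 <= w x) ->
    (forall m, \sum_(i < m)
       intg (fun x => `|g_ (K + i).+1 x - g_ (K + i)%N x| * w x) <= e) ->
  intg (fun x => `|limsup_fun g_ x - g_ K x| * w x) <= e.
Proof.
move=> tg lw w0 De.
have tgl := test_fun_limsup tg.
pose D i x := `|g_ (K + i).+1 x - g_ (K + i)%N x| * w x.
have lD f g : test_fun f -> test_fun g -> L1 (fun x => `|f x - g x| * w x).
  move=> tf tg'; have := L1B (L1M lw tf) (L1M lw tg') => /L1_abs.
  congr L1; apply/funext => x.
  by rewrite -mulrBr normrM (ger0_norm (w0 x)) mulrC.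
have D0 i x : 0 <= D i x by rewrite mulr_ge0.
rewrite -lee_fin EFin_intg; last exact: lD.
apply: (@le_trans _ _ (\int[mu]_x (\sum_(i <oo) (D i x)%:E)))%E.
  apply: ge0_le_integral => //.
  - by move=> x _; rewrite lee_fin mulr_ge0.
  - by apply/measurable_EFinP/(L1_measurable (mu := mu))/lD.
  - apply: (@ge0_emeasurable_sum _ _ _ _ (fun i x => (D i x)%:E) xpredT).
      by move=> i x _ _; rewrite lee_fin.
    by move=> i _; apply/measurable_EFinP/(L1_measurable (mu := mu))/lD.
  move=> x _.
  have S0 : (0 <= \sum_(i <oo) (D i x)%:E)%E.
    by apply: nneseries_ge0 => i _ _; rewrite lee_fin.
  have partial m : ((`|g_ (K + m)%N x - g_ K x| * w x)%:E <=
      \sum_(i <oo) (D i x)%:E)%E.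
    apply: (@le_trans _ _ (\sum_(0 <= i < m) (D i x)%:E)%E); last first.
      by apply: nneseries_lim_ge => i _; rewrite lee_fin.
    rewrite sumEFin lee_fin big_mkord.
    elim: m => [|m ih]; first by rewrite addn0 subrr normr0 mul0r big_ord0.
    rewrite big_ord_recr /= addnS.
    apply: (le_trans _ (lerD ih (lexx _))).
    by rewrite /D -mulrDl ler_wpM2r// [leRHS]addrC ler_distD.
  move: S0 partial; case: (\sum_(i <oo) _)%E => [s| |] //=; last first.
    by move=> _ _; rewrite leey.
  rewrite !lee_fin => s0 partial.
  have [->|wx0] := eqVneq (w x) 0; first by rewrite mulr0.
  have wx : 0 < w x by rewrite lt_neqAle eq_sym wx0 w0.
  rewrite -ler_pdivlMr// ler_distl.
  apply: (@limn_esup_between _ (g_ ^~ x) _ _ K) => n Kn.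
  by rewrite -ler_distl ler_pdivlMr// -(subnKC Kn); exact: partial.
rewrite integral_nneseries//; last 2 first.
- by move=> i; apply/measurable_EFinP/(L1_measurable (mu := mu))/lD.
- by move=> i x _; rewrite lee_fin.
apply: lime_le.
  apply: is_cvg_nneseries => i _ _.
  by apply: integral_ge0 => x _; rewrite lee_fin.
apply: nearW => m.
rewrite (eq_bigr (fun i => (intg (D i))%:E)) => [|i _]; last first.
  by rewrite EFin_intg//; exact: lD.
by rewrite sumEFin lee_fin big_mkord.
Qed.

Definition weakly_null (f : nat -> T -> R) := forall h, test_fun h ->
  intg (fun x => f n x * h x) @[n --> \oo] --> 0.

Definition partial_envelope (f : nat -> T -> R) N x : R :=
  \sum_(j < N) `|f j x|.

Lemma L1_partial_envelope (f : nat -> T -> R) N : (forall n, L1 (f n)) ->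
  L1 (partial_envelope f N).
Proof. by move=> lf; apply: L1_sum => i; exact: L1_abs. Qed.

Lemma le_partial_envelope (f : nat -> T -> R) N n x : (n < N)%N ->
  `|f n x| <= partial_envelope f N x.
Proof.
move=> nN; rewrite /partial_envelope (bigD1 (Ordinal nN))//=.
by rewrite lerDl sumr_ge0.
Qed.

Lemma partial_envelope_ge0 (f : nat -> T -> R) N x : 0 <= partial_envelope f N x.
Proof. exact: sumr_ge0. Qed.

(** Makes room for h: both [damp g h] and [damp g h + h] stay bounded by 1, and
both differ from g by at most a multiple of |h|. For h an indicator function it
restricts g to the complement of the set. *)
Definition damp (g h : T -> R) x := g x * (1 - `|h x|).

Lemma test_fun_damp g h : test_fun g -> test_fun h -> test_fun (damp g h).
Proof.
move=> [mg g1] [mh h1]; split.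
  apply: measurable_funM => //; apply: measurable_funB => //.
  exact: measurableT_comp.
move=> x; rewrite /damp normrM -[leRHS]mulr1 ler_pM//.
by rewrite ger0_norm ?subr_ge0// lerBlDr lerDl.
Qed.

Lemma test_fun_dampD g h : test_fun g -> test_fun h ->
  test_fun (fun x => damp g h x + h x).
Proof.
move=> tg th; split.
  by apply: measurable_funD; [case: (test_fun_damp tg th)|case: th].
move=> x; rewrite (le_trans (ler_normD _ _))// /damp normrM.
have [_ /(_ x) g1] := tg; have [_ /(_ x) h1] := th.
rewrite (@ger0_norm _ (1 - _)) ?subr_ge0//.
rewrite -lerBrDr -[leRHS]mul1r ler_wpM2r// subr_ge0//.
Qed.

(** Otherwise, for every N some h, whose weighted integral is below 2^-N, has
|integral of f_n h| > e for some n. Starting from g = 0, replace g by whichever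
of [damp g h] and [damp g h + h] pairs with f_n above e / 2; this is possible
since the two pairings differ by more than e. The next N exceeds n, so that all
the later changes, weighted by |f_n|, add up to at most a small number, and the
upper limit of the functions g still pairs with infinitely many f_n above e / 8
in absolute value. *)
Lemma equi_absolutely_continuous (f : nat -> T -> R) (e : R) :
    (forall n, L1 (f n)) -> weakly_null f -> 0 < e ->
  exists N, forall n h, test_fun h ->
    intg (fun x => `|h x| * partial_envelope f N x) < 2^-1 ^+ N ->
    `|intg (fun x => f n x * h x)| <= e.
Proof.
move=> lf wf e0; apply: contrapT => /forallNP contra.
have {contra} : forall N, exists p : nat * (T -> R), [/\ test_fun p.2,
    intg (fun x => `|p.2 x| * partial_envelope f N x) < 2^-1 ^+ N &
    e < `|intg (fun x => f p.1 x * p.2 x)|].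
  move=> N; apply: contrapT => nex; apply: (contra N) => n h th hN.
  by rewrite leNgt; apply/negP => hn; apply: nex; exists (n, h).
move=> /choice[p pP].
pose next (s : nat * (T -> R)) := let: (n, h) := p s.1 in
  ((maxn s.1 n).+1,
   if e / 2 < `|intg (fun x => f n x * damp s.2 h x)| then damp s.2 h
   else fun x => damp s.2 h x + h x).
pose S k := iter k next (0%N, cst 0).
pose N k := (S k).1; pose g k := (S k).2; pose n k := (p (N k)).1.
pose h k := (p (N k)).2.
have th k : test_fun (h k) by case: (pP (N k)).
have SE k : S k.+1 = ((maxn (N k) (n k)).+1,
   if e / 2 < `|intg (fun x => f (n k) x * damp (g k) (h k) x)|
   then damp (g k) (h k) else fun x => damp (g k) (h k) x + h k x).
  by rewrite /S iterS -/(S k) /next /N /n /g /h; case: (p (S k).1).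
have NS k : (N k < N k.+1)%N by rewrite /N SE/= ltnS leq_maxl.
have nN k : (n k < N k.+1)%N by rewrite /N SE/= ltnS leq_maxr.
have leN k l : (k <= l)%N -> (N k <= N l)%N.
  elim: l => [|l ih]; first by rewrite leqn0 => /eqP ->.
  rewrite leq_eqVlt ltnS => /predU1P[->//|/ih Nl].
  exact: leq_trans Nl (ltnW (NS _)).
have kN k : (k <= N k)%N.
  by elim: k => // k ih; exact: leq_ltn_trans ih (NS k).
have tg k : test_fun (g k).
  elim: k => [|k ih]; first by split => [|x]; rewrite /g/= ?normr0.
  rewrite /g SE/=; case: ifP => _; first exact: test_fun_damp.
  exact: test_fun_dampD.
have lfM m k : test_fun k -> L1 (fun x => f m x * k x) by move=> ?; apply: L1M.
have large k : e / 2 < `|intg (fun x => f (n k) x * g k.+1 x)|.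
  rewrite /g SE/=; case: ifPn => //; rewrite -leNgt => small.
  have -> : (fun x => f (n k) x * (damp (g k) (h k) x + h k x)) =
      (fun x => f (n k) x * damp (g k) (h k) x + f (n k) x * h k x).
    by apply/funext => x; rewrite mulrDr.
  rewrite intgD; [|exact/lfM/test_fun_damp|exact: lfM].
  have [_ _ big] := pP (N k).
  move: small big; rewrite -/(n k) -/(h k).
  set a := intg _; set b := intg _ => small big.
  have := ler_normB (a + b) a; rewrite addrAC subrr add0r; lra.
have step k x : `|g k.+1 x - g k x| <= 2 * `|h k x|.
  have [_ /(_ x) g1] := tg k.
  have gh : `|g k x * `|h k x| | <= `|h k x|.
    by rewrite normrM normr_id ler_piMl.
  rewrite /g SE -/(g k)/=; case: ifP => _; rewrite /damp.
    rewrite (_ : _ - _ = - (g k x * `|h k x|)); last by ring.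
    by rewrite normrN; have := normr_ge0 (h k x); lra.
  rewrite (_ : _ - _ = h k x - (g k x * `|h k x|)); last by ring.
  by rewrite (le_trans (ler_normB _ _))//; lra.
have lpe := L1_partial_envelope _ lf.
have lhpe k M : L1 (fun x => `|h k x| * partial_envelope f M x).
  have := L1_abs (L1M (lpe M) (th k)); congr L1; apply/funext => x.
  by rewrite normrM mulrC (ger0_norm (partial_envelope_ge0 _ _ _)).
have lD M a b : test_fun a -> test_fun b -> L1 (fun x => `|a x - b x| * `|f M x|).
  move=> ta tb; have := L1_abs (L1B (lfM M _ ta) (lfM M _ tb)).
  by congr L1; apply/funext => x; rewrite -mulrBr normrM mulrC.
have stepI k l : (k < l)%N ->
    intg (fun x => `|g l.+1 x - g l x| * `|f (n k) x|) <= 2 * 2^-1 ^+ l.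
  move=> kl; have [_ hl _] := pP (N l).
  apply: (@le_trans _ _ (intg (fun x => 2 * (`|h l x| * partial_envelope f (N l) x)))).
    apply: le_intg => [||x]; [exact: lD|exact: L1Z|].
    rewrite mulrA ler_pM// le_partial_envelope//.
    exact: leq_trans (nN k) (leN _ _ kl).
  rewrite intgZ// ler_pM2l// (le_trans (ltW hl))//.
  by rewrite ler_wiXn2l// invf_le1// ler1n.
have tail k : intg (fun x => `|limsup_fun g x - g k.+1 x| * `|f (n k) x|) <=
    2 * 2^-1 ^+ k.
  apply: intg_limsup_le => //; first exact: L1_abs.
  move=> m; apply: (@le_trans _ _ (\sum_(i < m) 2 * 2^-1 ^+ (k.+1 + i))).
    by apply: ler_sum => i _; apply: stepI; rewrite addSn ltnS leq_addr.
  suff -> : \sum_(i < m) 2 * 2^-1 ^+ (k.+1 + i) =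
      2 * 2^-1 ^+ k - 2 * 2^-1 ^+ (k + m) :> R.
    by rewrite lerBlDr lerDl mulr_ge0// exprn_ge0// invr_ge0.
  elim: m => [|m ih]; first by rewrite big_ord0 addn0 subrr.
  by rewrite big_ord_recr/= ih addnS addSn !exprS; lra.
have tG := test_fun_limsup tg.
have : \forall m \near \oo, 2^-1 ^+ m < e / 16 :> R.
  have /cvgr0_norm_lt : 2^-1 ^+ m @[m --> \oo] --> (0 : R).
    by apply: cvg_expr; rewrite ger0_norm ?invf_lt1 ?ltr1n.
  have e16 : 0 < e / 16 by rewrite divr_gt0.
  move=> /(_ _ e16); apply: filterS => m.
  exact/le_lt_trans/ler_norm.
have : \forall m \near \oo, `|intg (fun x => f m x * limsup_fun g x)| < e / 8.
  by move/cvgr0_norm_lt : (wf _ tG); apply; rewrite divr_gt0.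
move=> [M1 _ M1P] [M2 _ M2P].
pose k := maxn M1 M2.
have hk : 2^-1 ^+ k < e / 16 :> R by apply: M2P; rewrite /= leq_maxr.
(* If n_k were below N_k, the envelope would already dominate |f_(n_k)| and the
   pairing with h_k would be at most 2^-N_k, less than e. *)
have kn : (k <= n k)%N.
  rewrite leqNgt; apply/negP => nk.
  have [_ hb] := pP (N k); rewrite ltNge => /negP; apply.
  apply: (@le_trans _ _ (intg (fun x => `|h k x| * partial_envelope f (N k) x))).
    apply: intg_abs_le => [||x]; [exact: lfM (th k)|exact: lhpe|].
    rewrite normrM mulrC ler_wpM2l// le_partial_envelope//.
    exact: leq_trans nk (kN _).
  apply: (le_trans (ltW hb)); apply: (@le_trans _ _ (2^-1 ^+ k)).
    by rewrite ler_wiXn2l// invf_le1// ler1n.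
  by move: hk e0; set c := _ ^+ _; clear; lra.
have Gk : `|intg (fun x => f (n k) x * limsup_fun g x)| < e / 8.
  by apply: M1P; rewrite /= (leq_trans _ kn)// leq_maxl.
have := large k; rewrite ltNge => /negP; apply.
have -> : (fun x => f (n k) x * g k.+1 x) =
    (fun x => f (n k) x * limsup_fun g x -
      f (n k) x * (limsup_fun g x - g k.+1 x)).
  by apply/funext => x; ring.
have lt : L1 (fun x => f (n k) x * (limsup_fun g x - g k.+1 x)).
  under [X in L1 X]funext do rewrite mulrBr.
  exact: L1B (lfM _ _ tG) (lfM _ _ (tg _)).
rewrite intgB//; last exact: lfM.
rewrite (le_trans (ler_normB _ _))//.
have : `|intg (fun x => f (n k) x * (limsup_fun g x - g k.+1 x))| <= 2 * 2^-1 ^+ k.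
  apply: le_trans (tail k); apply: intg_abs_le => //; first exact: lD.
  by move=> x; rewrite normrM mulrC.
move: Gk hk e0; set a := `|_|; set b := `|_|; set c := _ ^+ _; clear; lra.
Qed.
End equi_absolute_continuity.

(** * Almost order boundedness *)

Section almost_order_bounded.
Context (d : measure_display) (T : measurableType d) (R : realType)
  (mu : {measure set T -> \bar R}).
Local Notation L1 := (L1 mu).
Local Notation intg := (intg mu).

(** A multiple c sgn f_n, with c small and independent of n, is small enough for
equi-absolute continuity to apply with e = 1. *)
Lemma weakly_null_bounded (f : nat -> T -> R) :
  (forall n, L1 (f n)) -> weakly_null mu f ->
  exists B, forall n, intg (fun x => `|f n x|) <= B.
Proof.
move=> lf wf.
have [N NP] := equi_absolutely_continuous lf wf ltr01.
have lpe := L1_partial_envelope N lf.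
set K := intg (partial_envelope f N) in NP *.
have K0 : 0 <= K by apply: intg_ge0 => x; exact: partial_envelope_ge0.
have N0 : 0 < 2^-1 ^+ N :> R by rewrite exprn_gt0// invr_gt0.
pose c : R := 2^-1 ^+ N / (K + 1).
have c0 : 0 < c by rewrite divr_gt0// ltr_wpDl.
exists c^-1 => n.
have mf := L1_measurable (lf n).
have [msg sg1] := test_fun_sg mf.
have th : test_fun (fun x => c * Num.sg (f n x)).
  split; first exact: measurable_funM.
  move=> x; rewrite normrM -[leRHS]mulr1 ler_pM// gtr0_norm// /c.
  rewrite ler_pdivrMr ?ltr_wpDl// mul1r (@le_trans _ _ 1)// ?lerDr//.
  by rewrite exprn_ile1// ?invr_ge0// invf_le1// ler1n.
have := NP n _ th.
have -> : (fun x => f n x * (c * Num.sg (f n x))) = (fun x => c * `|f n x|).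
  by apply/funext => x; rewrite mulrCA [f n x * _]mulrC -normrEsg.
rewrite intgZ; last exact: L1_abs.
rewrite normrM (gtr0_norm c0) ger0_norm; last exact: intg_ge0.
move=> h; rewrite -ler_pdivlMl// mulr1 in h *; apply: h.
apply: (@le_lt_trans _ _ (intg (fun x => c * partial_envelope f N x))).
  apply: le_intg => [||x].
  - have := L1_abs (L1M lpe th); congr L1; apply/funext => x.
    by rewrite normrM mulrC (ger0_norm (partial_envelope_ge0 _ _ _)).
  - exact: L1Z.
  - rewrite ler_wpM2r ?partial_envelope_ge0// normrM (gtr0_norm c0).
    by rewrite ler_piMr// ltW.
rewrite intgZ// -/K /c mulrAC ltr_pdivrMr ?ltr_wpDl//.
by rewrite ltr_pM2l// ltrDl.
Qed.

Definition clamp (b f : T -> R) x : R := Num.max (- b x) (Num.min (f x) (b x)).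

Lemma measurable_clamp b f : measurable_fun setT b -> measurable_fun setT f ->
  measurable_fun setT (clamp b f).
Proof.
move=> mb mf; apply: measurable_maxr; first exact: measurable_funN.
exact: measurable_minr.
Qed.

Lemma clamp_le b f x : 0 <= b x -> `|clamp b f x| <= b x.
Proof.
move=> b0; rewrite ler_norml /clamp le_max lexx/= ge_max ge_min lexx orbT andbT.
by rewrite -subr_ge0 opprK addr_ge0.
Qed.

Lemma clamp_id b f x : `|f x| <= b x -> clamp b f x = f x.
Proof.
rewrite ler_norml => /andP[bf fb].
by rewrite /clamp min_l// max_r.
Qed.

Lemma clamp_dist b f x : 0 <= b x -> `|f x - clamp b f x| <= `|f x|.
Proof.
move=> b0; rewrite /clamp; case: (lerP (f x) (b x)) => fb.
  case: (lerP (- b x) (f x)) => bf; first by rewrite subrr normr0.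
  have f0 : f x < 0 by lra.
  by rewrite !ltr0_norm//; lra.
rewrite max_r; last by lra.
by rewrite !gtr0_norm; lra.
Qed.

(** The bound b is a large multiple M of an envelope. On the set where |f_n| > b
the envelope is at most |f_n| / M, of small integral since the f_n are bounded
in L1; equi-absolute continuity then applies to the sign of f_n restricted to
that set. *)
Lemma weakly_null_almost_order_bounded (f : nat -> T -> R) (e : R) :
  (forall n, L1 (f n)) -> weakly_null mu f -> 0 < e ->
  exists b, [/\ L1 b, forall x, 0 <= b x &
    forall n, intg (fun x => `|f n x - clamp b (f n) x|) <= e].
Proof.
move=> lf wf e0.
have [B BP] := weakly_null_bounded lf wf.
have B0 : 0 <= B by apply: le_trans (BP 0%N); exact: intg_ge0.
have [N NP] := equi_absolutely_continuous lf wf e0.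
have lpe := L1_partial_envelope N lf.
have N0 : 0 < 2^-1 ^+ N :> R by rewrite exprn_gt0// invr_gt0.
pose M : R := (B + 1) / 2^-1 ^+ N.
have M0 : 0 < M by rewrite divr_gt0// ltr_wpDl.
exists (fun x => M * partial_envelope f N x).
have b0 x : 0 <= M * partial_envelope f N x.
  by rewrite mulr_ge0 ?(ltW M0) ?partial_envelope_ge0.
have lb : L1 (fun x => M * partial_envelope f N x) by exact: L1Z.
split => // n.
have mf := L1_measurable (lf n).
have [msg sg1] := test_fun_sg mf.
pose h x := if M * partial_envelope f N x < `|f n x| then Num.sg (f n x) else 0.
have th : test_fun h.
  split; last by move=> x; rewrite /h; case: ifP => // _; rewrite normr0.
  apply: measurable_fun_ifT => //.
  apply: measurable_fun_ltr; first exact: (L1_measurable lb).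
  exact: measurableT_comp.
have fh x : f n x * h x =
    if M * partial_envelope f N x < `|f n x| then `|f n x| else 0.
  by rewrite /h; case: ifP => _; rewrite ?mulr0// mulrC -normrEsg.
apply: (@le_trans _ _ `|intg (fun x => f n x * h x)|).
  apply: le_trans (ler_norm _); apply: le_intg => [||x].
  - apply: L1_abs; apply: L1B => //.
    apply: (L1_le _ _ lb).
      by apply: measurable_clamp => //; exact: (L1_measurable lb).
    by move=> x; rewrite (ger0_norm (b0 x)); exact: clamp_le.
  - exact: L1M.
  - rewrite fh; case: ltP => [_|fb]; first exact: clamp_dist.
    by rewrite clamp_id// subrr normr0.
apply: NP => //.
apply: (@le_lt_trans _ _ (intg (fun x => M^-1 * `|f n x|))).
  apply: le_intg => [||x].
  - have := L1_abs (L1M lpe th); congr L1; apply/funext => x.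
    by rewrite normrM mulrC (ger0_norm (partial_envelope_ge0 _ _ _)).
  - exact/L1Z/L1_abs.
  - rewrite ler_pdivlMl// mulrCA /h; case: ltP => fb.
      rewrite (le_trans _ (ltW fb))// ler_piMl//.
    by rewrite normr0 mul0r.
rewrite intgZ; last exact: L1_abs.
rewrite /M invf_div mulrAC ltr_pdivrMr ?ltr_wpDl// ltr_pM2l//.
by rewrite (le_lt_trans (BP n))// ltrDl.
Qed.

(** Weak lower semicontinuity of the norm, obtained by testing against sgn c. *)
Lemma weak_limit_norm_le (c : T -> R) (D : nat -> T -> R) (e : R) :
  L1 c -> (forall n, L1 (D n)) -> weakly_null mu D ->
  (forall n, intg (fun x => `|c x - D n x|) <= e) ->
  intg (fun x => `|c x|) <= e.
Proof.
move=> lc lD wD cDe.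
have tsg := test_fun_sg (L1_measurable lc).
apply/ler_addgt0Pr => r r0.
have /cvgr0_norm_lt /(_ _ r0) [n _ /(_ n (leqnn _)) Dr] := wD _ tsg.
have -> : (fun x => `|c x|) = (fun x => (c x - D n x) * Num.sg (c x) +
    D n x * Num.sg (c x)).
  by apply/funext => x; rewrite -mulrDl subrK mulrC -normrEsg.
rewrite intgD; [|exact: (L1M (L1B _ _))|exact: L1M].
apply: lerD; last by rewrite (le_trans (ler_norm _))// ltW.
apply: le_trans (cDe n).
rewrite (le_trans (ler_norm _))//; apply: intg_abs_le.
- exact: (L1M (L1B _ _)).
- exact/L1_abs/L1B.
- by case: tsg => _ s1 x; rewrite normrM ler_piMr.
Qed.

End almost_order_bounded.

(** * Extraction of a subsequence along an ultrafilter *)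

Section extraction.
Context (R : realType).

Lemma bounded_ultra_cvg (U : set_system nat) (x : nat -> R) (K : R) :
  UltraFilter U -> (forall n, `|x n| <= K) -> exists l : R, x @ U --> l.
Proof.
move=> UU xK.
have [|l [_ lU]] := @segment_compact R (- K) K (x @ U) _.
  by apply: nearW => n /=; rewrite in_itv/= -ler_norml.
exists l => V lV.
have [//|UnV] := in_ultra_setVsetC (x @^-1` V) UU.
by have [y [/= nVy Vy]] := lU (~` V) V UnV lV.
Qed.

(** Let a1 (i, n) be the limit of a i n m in m along a free ultrafilter, and l i
the limit of a1 (i, n) in n. The indices are chosen one after the other: for all
i up to the current rank, a new index m must make a1 (i, m) close to l i, and
a i n m close to a1 (i, n) for each n chosen before. Every choice involves only
finitely many sets of the ultrafilter, which is why infinitely many i can be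
treated by a single subsequence. *)
Lemma extract_double_limit (a : nat -> nat -> nat -> R) (K : nat -> R) :
  (forall i n m, `|a i n m| <= K i) ->
  exists (n_ : nat -> nat) (l : nat -> R), {homo n_ : i j / (i < j)%N} /\
    forall i (e : R), 0 < e -> exists p, forall j k, (p <= j)%N -> (j < k)%N ->
      `|a i (n_ j) (n_ k) - l i| <= e.
Proof.
move=> aK.
have [U [UU sU]] := ultraFilterLemma (eventually_filter).
have /choice[a1 a1P] (p : nat * nat) : exists l : R, a p.1 p.2 @ U --> l.
  exact: bounded_ultra_cvg (aK p.1 p.2).
have a1K i n : `|a1 (i, n)| <= K i.
  rewrite ler_norml; apply/andP; split.
    apply: (cvgr_to_ge (a1P (i, n))); apply: nearW => m /=.
    by have := aK i n m; rewrite ler_norml => /andP[].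
  apply: (cvgr_to_le (a1P (i, n))); apply: nearW => m /=.
  by have := aK i n m; rewrite ler_norml => /andP[].
have /choice[l lP] (i : nat) : exists l : R, (fun n => a1 (i, n)) @ U --> l.
  exact: bounded_ultra_cvg (a1K i).
have /choice[pick pickP] (s : seq nat) : exists m,
    [/\ forall q : 'I_(size s), (nth 0%N s q < m)%N,
        forall i : 'I_(size s).+1,
          `|l i - a1 (nat_of_ord i, m)| < (size s).+1%:R^-1 &
        forall (q : 'I_(size s)) (i : 'I_(size s).+1),
          `|a1 (nat_of_ord i, nth 0%N s q) - a i (nth 0%N s q) m| <
            (size s).+1%:R^-1].
  have e0 : 0 < (size s).+1%:R^-1 :> R by rewrite invr_gt0.
  apply: (@filter_ex _ U).
  near=> m; split.
  - near: m; apply: filter_forall => q; apply: sU.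
    by exists (nth 0%N s q).+1.
  - near: m; apply: filter_forall => i.
    by move/cvgr_dist_lt : (lP i); apply.
  - near: m; apply: filter_forall => q; apply: filter_forall => i.
    by move/cvgr_dist_lt : (a1P (nat_of_ord i, nth 0%N s q)); apply.
pose S k := iter k (fun s => rcons s (pick s)) [::].
have sizeS k : size (S k) = k by elim: k => // k ih; rewrite /= size_rcons ih.
have nthS j k : (j < k)%N -> nth 0%N (S k) j = pick (S j).
  elim: k => // k ih; rewrite ltnS leq_eqVlt => /predU1P[->|jk] /=.
    by rewrite nth_rcons sizeS ltnn eqxx.
  by rewrite nth_rcons sizeS jk ih.
exists (fun k => pick (S k)), l; split.
  move=> j k jk; have [+ _ _] := pickP (S k); rewrite sizeS => /(_ (Ordinal jk)) /=.
  by rewrite nthS.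
move=> i e e0.
have /cvgr0_norm_lt : (n.+1%:R^-1 : R) @[n --> \oo] --> (0 : R).
  exact: cvg_harmonic.
have e20 : 0 < e / 2 by rewrite divr_gt0.
move=> /(_ _ e20) [p0 _ p0P].
exists (maxn i p0) => j k; rewrite geq_max => /andP[ij p0j] jk.
have [_ + _] := pickP (S j); rewrite sizeS => /(_ (Ordinal (ij : (i < j.+1)%N))) /= h1.
have ik : (i < k.+1)%N by rewrite ltnS (leq_trans ij)// ltnW.
have [_ _ +] := pickP (S k).
rewrite sizeS => /(_ (Ordinal jk) (Ordinal ik)) /=; rewrite nthS// => h2.
have j2 : j.+1%:R^-1 < e / 2 :> R.
  exact: le_lt_trans (ler_norm _) (p0P _ p0j).
have k2 : k.+1%:R^-1 < e / 2 :> R.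
  by apply: le_lt_trans (ler_norm _) (p0P _ _); rewrite /= (leq_trans p0j)// ltnW.
rewrite distrC (le_trans (ler_distD (a1 (i, pick (S j))) _ _))//.
rewrite [leRHS]splitr lerD// ltW//; first exact: lt_trans h1 j2.
exact: lt_trans h2 k2.
Unshelve. all: by end_near. Qed.

End extraction.

(** * Almost orthogonality *)

Lemma homo_ltn_ge (x : nat -> nat) : {homo x : i j / (i < j)%N} ->
  forall n, (n <= x n)%N.
Proof. by move=> hx; elim=> // n ih; exact: leq_ltn_trans ih (hx _ _ _). Qed.

Lemma sum_ltn_le j m : (\sum_(q < j) (q < m) <= m)%N.
Proof.
suff -> : (\sum_(q < j) (q < m) = minn j m)%N by rewrite geq_minr.
elim: j => [|j ih]; first by rewrite big_ord0 min0n.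
by rewrite big_ord_recr/= ih; case: ltnP; lia.
Qed.

(** Counts, with multiplicity, the pairs (p, q) excluded from the asymptotic
estimate of the Gram entries: the diagonal and the pairs with an index below
m. *)
Lemma sum_defects_le j m :
  (\sum_(p < j) \sum_(q < j) ((p == q) + (p < m) + (q < m)) <= j * (1 + 2 * m))%N.
Proof.
under eq_bigr do rewrite !big_split.
rewrite !big_split/= [X in (_ + X + _)%N]exchange_big/=.
have -> : (j * (1 + 2 * m) = j * 1 + j * m + j * m)%N by lia.
have cst_le (c : nat) (F : 'I_j -> nat) : (forall p, F p <= c)%N ->
    (\sum_p F p <= j * c)%N.
  by move=> Fc; rewrite -[X in (_ <= X * _)%N]card_ord -sum_nat_const leq_sum.
rewrite !leq_add//; apply: cst_le => p; try exact: sum_ltn_le.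
by rewrite (bigD1 p)//= eqxx big1// => q; rewrite eq_sym => /negbTE ->.
Qed.

(** For distinct p and q from m on, the four entries involve distinct large
indices, so each is within eta of l, and l cancels in the alternating sum. For
the other pairs, O(j) in number, the sum is at most 4 K. *)
Lemma sum_gram_differences_le (R : realType) (A : nat -> nat -> R)
    (K l eta : R) (m j : nat) (x y : nat -> nat) :
  (forall i k, A i k = A k i) -> (forall i k, `|A i k| <= K) -> 0 <= eta ->
  (forall i k, (m <= i)%N -> (i < k)%N -> `|A i k - l| <= eta) ->
  {homo x : i k / (i < k)%N} -> {homo y : i k / (i < k)%N} ->
  (forall p q, (p < j)%N -> (x p < y q)%N) ->
  \sum_(p < j) \sum_(q < j)
    (A (x p) (x q) - A (x p) (y q) - A (y p) (x q) + A (y p) (y q)) <=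
  4 * eta * j%:R ^+ 2 + 4 * K * (1 + 2 * m%:R) * j%:R.
Proof.
move=> Asym AK eta0 Al hx hy xy.
have K0 : 0 <= K by apply: le_trans (AK 0%N 0%N).
have inj_homo (z : nat -> nat) : {homo z : i k / (i < k)%N} ->
    forall p q, p != q -> z p != z q.
  move=> hz p q; rewrite !neq_ltn => /orP[/hz ->//|/hz ->]; exact: orbT.
have near i k : (m <= i)%N -> (m <= k)%N -> i != k -> `|A i k - l| <= eta.
  move=> mi mk; rewrite neq_ltn => /orP[ik|ki]; first exact: Al.
  by rewrite Asym; exact: Al.
have bound (p q : 'I_j) :
    A (x p) (x q) - A (x p) (y q) - A (y p) (x q) + A (y p) (y q) <=
    4 * eta + 4 * K * ((p == q) + (p < m) + (q < m))%:R.
  have [good|bad] := boolP [&& p != q, (m <= p)%N & (m <= q)%N].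
    case/and3P: good => pq mp mq.
    have [mxp mxq] : (m <= x p)%N /\ (m <= x q)%N.
      by split; [apply: leq_trans mp _|apply: leq_trans mq _]; exact: homo_ltn_ge.
    have [myp myq] : (m <= y p)%N /\ (m <= y q)%N.
      by split; [apply: leq_trans mp _|apply: leq_trans mq _]; exact: homo_ltn_ge.
    have := near _ _ mxp mxq (inj_homo _ hx _ _ pq).
    have := near _ _ myp myq (inj_homo _ hy _ _ pq).
    have := near (x p) (y q) mxp myq.
    rewrite neq_ltn xy ?ltn_ord// => /(_ isT).
    have := near (y p) (x q) myp mxq.
    rewrite neq_ltn xy ?orbT ?ltn_ord// => /(_ isT).
    have : 0 <= 4 * K * ((p == q) + (p < m) + (q < m))%:R :> R.
      by rewrite !mulr_ge0.
    rewrite !ler_norml; move: (A _ _) (A _ _) (A _ _) (A _ _) (_ * _%:R).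
    clear; move=> *; lra.
  have : 4 * K <= 4 * K * ((p == q) + (p < m) + (q < m))%:R.
    rewrite -[leLHS]mulr1 ler_wpM2l ?mulr_ge0// ler1n.
    by move: bad; rewrite !negb_and negbK -!ltnNge; case: (p == q); case: (p < m)%N;
       case: (q < m)%N.
  move: (AK (x p) (x q)) (AK (x p) (y q)) (AK (y p) (x q)) (AK (y p) (y q)) eta0.
  rewrite !ler_norml; move: (A _ _) (A _ _) (A _ _) (A _ _) (_ * _%:R).
  clear; move=> *; lra.
apply: (le_trans (ler_sum _ (fun p _ => ler_sum _ (fun q _ => bound p q)))).
have -> : \sum_(p < j) \sum_(q < j)
      (4 * eta + 4 * K * ((p == q) + (p < m) + (q < m))%:R) =
    4 * eta * j%:R ^+ 2 + 4 * K *
      (\sum_(p < j) \sum_(q < j) ((p == q) + (p < m) + (q < m)))%N%:R :> R.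
  under eq_bigr do rewrite big_split/= sumr_const card_ord -mulr_sumr -natr_sum.
  rewrite big_split/= sumr_const card_ord -mulr_sumr -natr_sum; congr +%R.
  by rewrite -[LHS]mulr_natr -[X in X * _]mulr_natr expr2 mulrA.
rewrite lerD2l -[leRHS]mulrA ler_wpM2l ?mulr_ge0//.
by rewrite -natrM nat1r -natrM ler_nat (leq_trans (sum_defects_le _ _))// mulnC.
Qed.

(** Integrated, it bounds an L1 norm by a squared norm in the weighted Hilbert
space, in the manner of the Cauchy-Schwarz inequality. *)
Lemma weighted_young (R : realType) (v b lam : R) :
  0 <= b -> (b = 0 -> v = 0) -> 0 < lam ->
  `|v| <= lam / 2 * b + (2 * lam)^-1 * (v * v / b).
Proof.
move=> b0 vb l0; have [b00|bn0] := eqVneq b 0.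
  by rewrite (vb b00) b00 !(mulr0, mul0r, normr0, addr0).
have bp : 0 < b by rewrite lt_neqAle eq_sym bn0.
have -> : v * v = `|v| * `|v| by rewrite -normrM ger0_norm// -expr2 sqr_ge0.
move: `|v| => y.
rewrite -subr_ge0.
have -> : lam / 2 * b + (2 * lam)^-1 * (y * y / b) - y =
    (lam * b - y) ^+ 2 * (2 * lam * b)^-1 by field; rewrite !gt_eqF.
by rewrite mulr_ge0 ?sqr_ge0// invr_ge0 !mulr_ge0// ltW.
Qed.

Section cesaro.
Context (d : measure_display) (T : measurableType d) (R : realType)
  (mu : {measure set T -> \bar R}).
Local Notation L1 := (L1 mu).
Local Notation intg := (intg mu).

(** The inner product of the L2 space of the measure mu / b. The functions
considered vanish where b does, in accordance with the convention 0^-1 = 0. *)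
Definition gram (b s t : T -> R) : R := intg (fun x => s x * t x / b x).

Lemma gram_term_le (b s t : T -> R) x : `|s x| <= b x -> `|t x| <= b x ->
  `|s x * t x / b x| <= b x.
Proof.
move=> sb tb; have b0 : 0 <= b x by apply: le_trans sb.
have [bx0|bx0] := eqVneq (b x) 0; first by rewrite bx0 invr0 mulr0 normr0.
have bx : 0 < b x by rewrite lt_neqAle eq_sym bx0 b0.
by rewrite normrM normfV (ger0_norm b0) ler_pdivrMr// normrM ler_pM.
Qed.

Lemma L1_gram (b s t : T -> R) : L1 b ->
  measurable_fun setT s -> measurable_fun setT t ->
  (forall x, `|s x| <= b x) -> (forall x, `|t x| <= b x) ->
  L1 (fun x => s x * t x / b x).
Proof.
move=> lb ms mt sb tb.
have b0 x : 0 <= b x by apply: le_trans (sb x).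
apply: (L1_le _ _ lb); last by move=> x; rewrite (ger0_norm (b0 x)) gram_term_le.
apply: measurable_funM; first exact: measurable_funM.
(* The inverse is not continuous at 0, but on nonnegative numbers it agrees with
   a real power function. *)
have -> : (fun x => (b x)^-1) = (fun x => b x `^ (-1)).
  by apply/funext => x; rewrite powR_inv1.
apply: (measurableT_comp (measurable_powR (-1))).
exact: L1_measurable lb.
Qed.

Lemma gram_le (b s t : T -> R) : L1 b ->
  measurable_fun setT s -> measurable_fun setT t ->
  (forall x, `|s x| <= b x) -> (forall x, `|t x| <= b x) ->
  `|gram b s t| <= intg b.
Proof.
move=> lb ms mt sb tb; apply: intg_abs_le => //; first exact: L1_gram.
by move=> x; exact: gram_term_le.
Qed.

Lemma gramC (b s t : T -> R) : gram b s t = gram b t s.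
Proof. by congr intg; apply/funext => x; rewrite [s x * _]mulrC. Qed.

(** The factor of j can be made small by the choice of lam and then of eta, and
the other term does not depend on j: dividing by j gives means that are small
uniformly in x and y. *)
Lemma intg_sum_differences_le (b : T -> R) (t : nat -> T -> R) (l eta lam : R)
    (m j : nat) (x y : nat -> nat) :
  L1 b -> (forall n, measurable_fun setT (t n)) ->
  (forall n z, `|t n z| <= b z) -> 0 <= eta -> 0 < lam -> (0 < j)%N ->
  (forall i k, (m <= i)%N -> (i < k)%N -> `|gram b (t i) (t k) - l| <= eta) ->
  {homo x : i k / (i < k)%N} -> {homo y : i k / (i < k)%N} ->
  (forall p q, (p < j)%N -> (x p < y q)%N) ->
  intg (fun z => `|\sum_(p < j) (t (x p) z - t (y p) z)|) <=
  j%:R * (lam * intg b / 2 + 2 * eta / lam) +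
    2 * intg b * (1 + 2 * m%:R) / lam.
Proof.
move=> lb mt tb eta0 lam0 j0 tl hx hy xy.
have b0 z : 0 <= b z by apply: le_trans (tb 0%N z).
have lt n : L1 (t n).
  by apply: (L1_le _ _ lb) => // z; rewrite (ger0_norm (b0 z)).
have lg i k : L1 (fun z => t i z * t k z / b z) by exact: L1_gram.
pose w (p q : 'I_j) z := t (x p) z * t (x q) z / b z - t (x p) z * t (y q) z / b z
  - t (y p) z * t (x q) z / b z + t (y p) z * t (y q) z / b z.
have lw p q : L1 (w p q) by apply: L1D => //; apply: L1B => //; exact: L1B.
have wE p q : intg (w p q) = gram b (t (x p)) (t (x q)) - gram b (t (x p)) (t (y q))
    - gram b (t (y p)) (t (x q)) + gram b (t (y p)) (t (y q)).
  by rewrite /w intgD ?intgB//; repeat apply: L1B.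
have lW : L1 (fun z => \sum_(p < j) \sum_(q < j) w p q z).
  by apply: L1_sum => p; exact: L1_sum.
have jR : 0 < j%:R :> R by rewrite ltr0n.
have lj0 : 0 < lam * j%:R by rewrite mulr_gt0.
apply: (@le_trans _ _ (intg (fun z => lam * j%:R / 2 * b z +
    (2 * (lam * j%:R))^-1 * \sum_(p < j) \sum_(q < j) w p q z))).
  apply: le_intg => [||z].
  - by apply/L1_abs/L1_sum => p; exact: L1B.
  - by apply: L1D; exact: L1Z.
  have -> : \sum_(p < j) \sum_(q < j) w p q z =
      (\sum_(p < j) (t (x p) z - t (y p) z)) *
      (\sum_(p < j) (t (x p) z - t (y p) z)) / b z.
    rewrite big_distrlr/= mulr_suml; apply: eq_bigr => p _.
    by rewrite mulr_suml; apply: eq_bigr => q _; rewrite /w; ring.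
  apply: weighted_young => // bz; rewrite big1// => p _.
  have t0 n : t n z = 0 by apply/eqP; rewrite -normr_le0 -bz.
  by rewrite !t0 subrr.
rewrite intgD; [|exact: L1Z|exact: L1Z].
rewrite !intgZ// intg_sum; last by move=> p; exact: L1_sum.
under eq_bigr do rewrite intg_sum//.
under eq_bigr do under eq_bigr do rewrite wE.
have AK i k : `|gram b (t i) (t k)| <= intg b by exact: gram_le.
have := sum_gram_differences_le (fun i k => gramC b (t i) (t k)) AK eta0 tl hx hy xy.
set S := \sum_(p < j) _ => SQ.
apply: (@le_trans _ _ (lam * j%:R / 2 * intg b + (2 * (lam * j%:R))^-1 *
    (4 * eta * j%:R ^+ 2 + 4 * intg b * (1 + 2 * m%:R) * j%:R))).
  by rewrite lerD2l ler_wpM2l// invr_ge0 mulr_ge0// ltW.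
rewrite le_eqVlt; apply/orP; left; apply/eqP; field.
by rewrite !gt_eqF.
Qed.

End cesaro.

(** * Uniform convergence of the means *)

Section uniform_cesaro.
Context (d : measure_display) (T : measurableType d) (R : realType)
  (mu : {measure set T -> \bar R}).
Local Notation L1 := (L1 mu).
Local Notation intg := (intg mu).

Lemma weakly_null_comp (f : nat -> T -> R) (s : nat -> nat) :
  (forall n, (n <= s n)%N) -> weakly_null mu f -> weakly_null mu (f \o s).
Proof.
move=> ns wf h th.
have soo : s @ \oo --> \oo.
  by move=> A [N _ NA]; exists N => // n /= Nn; apply: NA; exact: leq_trans (ns n).
exact: cvg_comp soo (wf h th).
Qed.

Lemma weakly_null_mean (F : nat -> nat -> T -> R) (j : nat) :
  (forall p n, L1 (F p n)) -> (forall p, weakly_null mu (F p)) ->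
  weakly_null mu (fun n x => j%:R^-1 * \sum_(p < j) F p n x).
Proof.
move=> lF wF h th.
have -> : (fun n => intg (fun x => j%:R^-1 * (\sum_(p < j) F p n x) * h x)) =
    (fun n => j%:R^-1 * \sum_(p < j) intg (fun x => F p n x * h x)).
  apply/funext => n; rewrite -intg_sum; last by move=> p; exact: L1M.
  rewrite -intgZ; last by apply: L1_sum => p; exact: L1M.
  by congr intg; apply/funext => x; rewrite -mulrA mulr_suml.
suff cvgS m : \sum_(p < m) intg (fun x => F p n x * h x) @[n --> \oo] --> (0 : R).
  by have := @cvgMl_tmp R _ \oo _ _ j%:R^-1 _ (cvgS j); rewrite mulr0; apply.
elim: m => [|m ih].
  by under eq_fun do rewrite big_ord0; exact: cvg_cst.
under eq_fun do rewrite big_ord_recr/=.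
by have := cvgD ih (wF m h th); rewrite addr0; apply.
Qed.

(** The mean along s is compared with means along indices beyond s j + N, for all
N. Passing from f to its truncation costs e for each of the two means, and the
difference of the truncated means contributes a third e. *)
Lemma uniform_cesaro_le (f : nat -> T -> R) (b : T -> R) (l e : R) :
  (forall n, L1 (f n)) -> weakly_null mu f -> L1 b -> (forall x, 0 <= b x) ->
  0 < e -> (forall n, intg (fun x => `|f n x - clamp b (f n) x|) <= e) ->
  (forall eta, 0 < eta -> exists m, forall i k, (m <= i)%N -> (i < k)%N ->
    `|gram mu b (clamp b (f i)) (clamp b (f k)) - l| <= eta) ->
  \forall j \near \oo, forall s : nat -> nat, {homo s : i k / (i < k)%N} ->
    intg (fun x => `|j%:R^-1 * \sum_(k < j) f (s k) x|) <= 3 * e.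
Proof.
move=> lf wf lb b0 e0 fb gb.
set K := intg b.
have K0 : 0 <= K by exact: intg_ge0.
(* With these choices of lam and eta the three terms of
   [intg_sum_differences_le], divided by j, are at most e / 2, e / 4, e / 4. *)
pose lam := e / (K + 1).
have lam0 : 0 < lam by rewrite divr_gt0// ltr_wpDl.
have eta0 : 0 < lam * e / 8 by rewrite divr_gt0// mulr_gt0.
have [m mP] := gb _ eta0.
have lt n : L1 (clamp b (f n)).
  apply: (L1_le _ _ lb); last by move=> x; rewrite (ger0_norm (b0 x)) clamp_le.
  by apply: measurable_clamp; apply: L1_measurable; [exact: lb|exact: lf].
pose C := 2 * K * (1 + 2 * m%:R) / lam.
have C0 : 0 <= C by rewrite /C divr_ge0 ?(ltW lam0)// !mulr_ge0// addr_ge0// mulr_ge0.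
near=> j => s hs.
have j0 : (0 < j)%N by near: j; exists 1%N.
have jR : 0 < j%:R :> R by rewrite ltr0n.
have Cj : C <= j%:R * (e / 4).
  rewrite -ler_pdivrMr; last by rewrite divr_gt0.
  by near: j; exact: nbhs_infty_ger.
pose y N q := (s j + N + q)%N.
apply: (@weak_limit_norm_le _ _ _ _ _
    (fun N x => j%:R^-1 * \sum_(p < j) f (y N p) x)).
- by apply: L1Z; apply: L1_sum.
- by move=> N; apply: L1Z; apply: L1_sum.
- apply: (@weakly_null_mean (fun p N => f (y N p)) j) => [//|p].
  by apply: (@weakly_null_comp f (fun N => y N p)) => // n; rewrite /y; lia.
move=> N.
have -> : (fun x => `|j%:R^-1 * \sum_(k < j) f (s k) x -
      j%:R^-1 * \sum_(p < j) f (y N p) x|) =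
    (fun x => j%:R^-1 * `|\sum_(p < j) (f (s p) x - f (y N p) x)|).
  apply/funext => x; rewrite -mulrBr normrM (@ger0_norm _ j%:R^-1).
    by rewrite -sumrB.
  by rewrite invr_ge0.
have lfB i k : L1 (fun x => f i x - f k x) by exact: L1B.
have ltB i k : L1 (fun x => clamp b (f i) x - clamp b (f k) x) by exact: L1B.
have lr n : L1 (fun x => `|f n x - clamp b (f n) x|) by apply/L1_abs/L1B.
rewrite intgZ; last by apply/L1_abs/L1_sum => p; exact: lfB.
rewrite mulrC ler_pdivrMr//.
apply: (@le_trans _ _ (intg (fun x =>
   \sum_(p < j) (`|f (s p) x - clamp b (f (s p)) x| +
     `|f (y N p) x - clamp b (f (y N p)) x|) +
   `|\sum_(p < j) (clamp b (f (s p)) x - clamp b (f (y N p)) x)|))).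
  apply: le_intg => [||x].
  - by apply/L1_abs/L1_sum => p; exact: lfB.
  - apply: L1D; first by apply: L1_sum => p; exact: L1D.
    by apply/L1_abs/L1_sum => p; exact: ltB.
  rewrite -lerBlDr (le_trans (lerB_dist _ _))// -sumrB.
  rewrite (le_trans (ler_norm_sum _ _ _))// ler_sum// => p _.
  apply: le_trans (ler_normB _ _).
  by rewrite le_eqVlt; apply/orP; left; apply/eqP; congr `|_|; ring.
rewrite intgD; last 2 first.
- by apply: L1_sum => p; exact: L1D.
- by apply/L1_abs/L1_sum => p; exact: ltB.
have -> : 3 * e * j%:R = 2 * e * j%:R + e * j%:R by ring.
apply: lerD.
  rewrite intg_sum; last by move=> p; exact: L1D.
  rewrite mulr_natr -[X in _ *+ X]card_ord -sumr_const ler_sum// => p _.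
  by rewrite intgD// (_ : 2 * e = e + e) ?lerD//; ring.
have := @intg_sum_differences_le _ _ _ mu b (fun n => clamp b (f n)) l
  (lam * e / 8) lam m j s (y N) lb _ _ (ltW eta0) lam0 j0 mP hs _ _.
rewrite -/K -/C => /(_ _ _ _ _) /le_trans; apply.
- by move=> n; exact: L1_measurable (lt n).
- by move=> n z; exact: clamp_le.
- by move=> p q; rewrite /y ltn_add2l.
- by move=> p q pj; rewrite /y -addnA (leq_trans (hs _ _ pj))// leq_addr.
have h1 : lam * K <= e.
  by rewrite /lam mulrAC ler_pdivrMr ?ltr_wpDl// ler_wpM2l ?lerDl// ltW.
have h2 : 2 * (lam * e / 8) / lam = e / 4 by field; rewrite gt_eqF.
rewrite h2; apply: (@le_trans _ _ (j%:R * (e / 2 + e / 4) + j%:R * (e / 4))).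
  rewrite lerD// ler_wpM2l// lerD2r ler_pM2r//.
rewrite le_eqVlt; apply/orP; left; apply/eqP; field.
Unshelve. all: by end_near. Qed.

Lemma uniform_cesaro_subsequence (f : nat -> T -> R) :
  (forall n, L1 (f n)) -> weakly_null mu f ->
  exists2 n_ : nat -> nat, {homo n_ : i j / (i < j)%N} &
    forall e : R, 0 < e ->
      \forall j \near \oo, forall s : nat -> nat, {homo s : i k / (i < k)%N} ->
        intg (fun x => `|j%:R^-1 * \sum_(k < j) f (n_ (s k)) x|) <= e.
Proof.
move=> lf wf.
have e0 i : 0 < i.+1%:R^-1 :> R by rewrite invr_gt0.
have /choice[b bP] i := weakly_null_almost_order_bounded lf wf (e0 i).
pose a i n m := gram mu (b i) (clamp (b i) (f n)) (clamp (b i) (f m)).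
have aK i n m : `|a i n m| <= intg (b i).
  have [lb b0 _] := bP i.
  apply: gram_le => //; try by move=> x; exact: clamp_le.
  - by apply: measurable_clamp; apply: L1_measurable; [exact: lb|exact: lf].
  - by apply: measurable_clamp; apply: L1_measurable; [exact: lb|exact: lf].
have [n_ [l [hn nP]]] := extract_double_limit aK.
exists n_ => // e ep.
have [i ie] : exists i : nat, 3 * i.+1%:R^-1 < e :> R.
  have /cvgr0_norm_lt : (n.+1%:R^-1 : R) @[n --> \oo] --> (0 : R).
    exact: cvg_harmonic.
  have e3 : 0 < e / 3 by rewrite divr_gt0.
  move=> /(_ _ e3) [i _ /(_ i (leqnn i)) /= hi]; exists i.
  by rewrite mulrC -ltr_pdivlMr// (le_lt_trans (ler_norm _)).
have [lb b0 fb] := bP i.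
have lfn n : L1 (f (n_ n)) by [].
have wfn : weakly_null mu (f \o n_) by apply: weakly_null_comp => //; exact: homo_ltn_ge.
have := @uniform_cesaro_le (f \o n_) (b i) (l i) _ lfn wfn lb b0 (e0 i)
  (fun n => fb (n_ n)) (nP i).
apply: filterS => j + s hs => /(_ s hs) /le_trans; apply; exact: ltW.
Qed.

End uniform_cesaro.

Theorem theorem1p2 (d : measure_display) (T : measurableType d) (R : realType)
    (mu : {measure set T -> \bar R}) (u_ : nat -> L1fun mu) (u : L1fun mu) :
  L1_weak_cvg u_ u ->
  exists2 n_ : nat -> nat, {homo n_ : i j / (i < j)%N} &
    ereal_sup [set (L1norm (j%:R^-1 *: (\sum_(k < j) u_ (n_ (theta k))) - u))%:E
              | theta in [set theta : nat -> nat | {homo theta : i k / (i < k)%N}]]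
      @[j --> \oo] --> 0%E.
Proof.
move=> wu.
pose f n x := u_ n x - u x.
have lf n : L1 mu (f n) by apply: L1B; exact: L1fun_L1.
have wf : weakly_null mu f by move=> h; exact: weak_cvg_test.
have [n_ hn nP] := uniform_cesaro_subsequence lf wf.
exists n_ => //.
have normE j (s : nat -> nat) : (0 < j)%N ->
    L1norm (j%:R^-1 *: (\sum_(k < j) u_ (n_ (s k))) - u) =
    intg mu (fun x => `|j%:R^-1 * \sum_(k < j) f (n_ (s k)) x|).
  move=> j0; rewrite L1normE; congr intg; apply/funext => x /=.
  congr `|_|; rewrite sumrB sumr_const card_ord mulrBr -[u x *+ _]mulr_natl.
  rewrite mulKf ?pnatr_eq0 -?lt0n//.
  congr (_ * _ - _).
  by elim/big_ind2: _ => //= ? ? ? ? <- <-.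
set S := fun j => ereal_sup _.
have S0 j : (0 <= S j)%E.
  apply: (@le_trans _ _ (L1norm (j%:R^-1 *: (\sum_(k < j) u_ (n_ k)) - u))%:E).
    by rewrite lee_fin L1normE intg_ge0.
  by apply: ereal_sup_ubound; exists id.
have Se (e : R) : 0 < e -> \forall j \near \oo, (S j <= e%:E)%E.
  move=> e0; near=> j; apply: ge_ereal_sup => _ [s hs <-].
  rewrite lee_fin normE; last by near: j; exists 1%N.
  by move: s hs; near: j; exact: nP.
apply/fine_cvgP; split.
  apply: filterS (Se 1 ltr01) => j Sj.
  by rewrite ge0_fin_numE// (le_lt_trans Sj)// ltry.
apply/cvgr0Pnorm_le => e e0; apply: filterS (Se e e0) => j /= Sj.
have Sfin : S j \is a fin_num by rewrite ge0_fin_numE// (le_lt_trans Sj)// ltry.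
by rewrite ger0_norm ?fine_ge0// -lee_fin fineK.
Unshelve. all: by end_near. Qed.
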